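(* Let $X$ be a Banach space. Let $\mathbf A: X\otimes(S)_{-1}\to X\otimes(S)_{-1}$ be a coordinatewise operator and $\mathbf B\lozenge: X\otimes(S)_{-1}\to X\otimes(S)_{-1}$ the Wick-type operator $\mathbf B\lozenge U=\sum_{\alpha\in\mathcal I}\sum_{\beta\le\alpha}B_\beta(u_{\alpha-\beta})H_\alpha$ associated with a family $\{B_\alpha\}_{\alpha\in\mathcal I}$ of bounded linear operators on $X$, for which the following hold: 1. $\mathbf A=\widetilde{\mathbf A}+\mathbf C$, where $\widetilde{\mathbf A}(U)=\sum_{\alpha\in\mathcal I}\widetilde A_\alpha(u_\alpha)H_\alpha$ with $\widetilde A_\alpha:X\to X$ compact (linear) operators for all $\alpha\in\mathcal I$, and $\mathbf C(U)=\sum_{\alpha\in\mathcal I}r_\alpha u_\alpha H_\alpha$ with $r_\alpha\in\mathbb R$, $\alpha\in\mathcal I$; and $B_{\mathbf 0}:X\to X$ is a compact operator. There exists $K>0$ such that $$-\|\widetilde A_\alpha\|-\|B_{\mathbf 0}\|-r_\alpha\ge 0\quad\text{for all }\alpha\in\mathcal I,\qquad \sup_{\alpha\in\mathcal I}\left(\frac{1}{-r_\alpha-\|\widetilde A_\alpha\|-\|B_{\mathbf 0}\|}\right)<K$$ (where $1/0$ is understood as $+\infty$, so that all the denominators are in fact positive). 2. The operators $B_\beta:X\to X$, $\beta\in\mathcal I\setminus\{\mathbf 0\}$, are bounded and there exists $p>0$ such that $$K\sum_{\beta\in\mathcal I,\ \beta>\mathbf 0}\|B_\beta\|(2\mathbb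 N)^{-p\beta/2}<\frac{1}{\sqrt 2}.$$ 3. For every $\alpha\in\mathcal I$, $$\mathrm{Ker}\big(\widetilde A_\alpha+(1+r_\alpha)\mathrm{Id}+B_{\mathbf 0}\big)=\{0\}.$$ Then, for every $F\in X\otimes(S)_{-1,-p}$ there exists a unique solution $U\in X\otimes(S)_{-1,-p}$ to the equation $$\mathbf A U+\mathbf B\lozenge U+F=0 .$$
   Context: $\mathcal I=(\mathbb N_0^{\mathbb N})_c$ is the set of sequences $\alpha=(\alpha_1,\alpha_2,\dots)$ of non-negative integers with only finitely many nonzero entries; $\mathbf 0$ is the zero multi-index; operations and order are componentwise, and $\beta>\mathbf 0$ means $\beta\ne\mathbf 0$. $(2\mathbb N)^{c\alpha}=\prod_{n\ge1}(2n)^{c\alpha_n}$ for real $c$. $\{H_\alpha\}_{\alpha\in\mathcal I}$ is the Fourier–Hermite orthogonal basis of $L^2(S'(\mathbb R),\mu)$, $\mu$ the Gaussian white noise measure. Expansions $\sum_\alpha u_\alpha H_\alpha$ are formal series identified with their coefficient families $(u_\alpha)_{\alpha\in\mathcal I}$ (uniqueness of the chaos expansion). For $p\ge0$, $X\otimes(S)_{-1,-p}$ is the space of expansions $U=\sum_\alpha u_\alpha H_\alpha$, $u_\alpha\in X$, with $\sum_\alpha\|u_\alpha\|_X^2(2\mathbb N)^{-p\alpha}<\infty$, and $X\otimes(S)_{-1}=\bigcup_p X\otimes(S)_{-1,-p}$. An operator $\mathbf O$ on $X\otimes(S)_{-1}$ is coordinatewise if there are operators $o_\alpha:X\to X$,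 $\alpha\in\mathcal I$, with $\mathbf O(\sum_\alpha f_\alpha H_\alpha)=\sum_\alpha o_\alpha(f_\alpha)H_\alpha$. All norms of operators are operator norms in $L(X)$. The equation $\mathbf AU+\mathbf B\lozenge U+F=0$ is understood coefficientwise: $\widetilde A_\alpha u_\alpha+r_\alpha u_\alpha+\sum_{\beta\le\alpha}B_\beta u_{\alpha-\beta}+f_\alpha=0$ for all $\alpha\in\mathcal I$. *)

(* Defs.v *)
From HB Require Import structures.
From mathcomp Require Import all_boot all_order all_algebra finmap.
From mathcomp Require Import all_classical all_reals all_analysis.

Set Implicit Arguments.
Unset Strict Implicit.
Unset Printing Implicit Defensive.

Import Order.TTheory GRing.Theory Num.Theory.
Import numFieldNormedType.Exports.

Local Open Scope classical_set_scope.
Local Open Scope ring_scope.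

(* Multi-indices are numbered from 0: [a n] is the entry alpha_(n+1). *)
Notation mindex := {fsfun nat -> nat with 0%N}.

Definition mindex0 : mindex := [fsfun].

Definition mindex_le (b a : mindex) : Prop := forall n, (b n <= a n)%N.

(* Truncated subtraction; only meaningful for [mindex_le b a]. *)
Definition mindex_sub (a b : mindex) : mindex :=
  [fsfun n in finsupp a => (a n - b n)%N].

Lemma mindex_subE (a b : mindex) n : mindex_sub a b n = (a n - b n)%N.
Proof.
by rewrite /mindex_sub fsfun_fun; case: finsuppP => // _; rewrite sub0n.
Qed.

(* Makes the finitely supported sum in [wick] a genuine sum over b <= a. *)
Lemma finite_mindex_le (a : mindex) : finite_set [set b | mindex_le b a].
Proof.
pose M := (\max_(n <- finsupp a) a n)%N.
pose g (h : {ffun finsupp a -> 'I_M.+1}) : mindex :=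
  [fsfun n : finsupp a => (h n : nat)].
apply: (@sub_finite_set _ _ (range g)); last exact: finite_image.
move=> b /= ba.
exists [ffun n : finsupp a => inord (b (val n))] => //.
apply/fsfunP => n; rewrite fsfun_ffun.
case: insubP => [k kn kE|na] /=; last first.
  by have := ba n; rewrite (fsfun_dflt na) leqn0 => /eqP.
rewrite ffunE kE inordK // ltnS.
by rewrite (leq_trans (ba n)) // /M; apply: leq_bigmax_seq; rewrite // -kE valP.
Qed.

(* (2N)^(c alpha) *)
Definition weight (R : realType) (c : R) (a : mindex) : R :=
  \prod_(n <- finsupp a) ((2 * n.+1)%:R `^ (c * (a n)%:R)).

(* An expansion sum_alpha u_alpha H_alpha is its family of coefficients
   [u : mindex -> X]; [kondratiev X p] is the space X (x) (S)_(-1,-p). *)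
Definition kondratiev (R : realType) (X : normedModType R) (p : R) :
    set (mindex -> X) :=
  [set u | (\esum_(a in [set: mindex])
              (`|u a| ^+ 2 * weight (- p) a)%:E < +oo)%E].

Arguments kondratiev {R} X p.

Definition kondratiev_union (R : realType) (X : normedModType R) :
    set (mindex -> X) :=
  \bigcup_(p in [set p : R | 0 <= p]) kondratiev X p.

Arguments kondratiev_union {R} X.

Definition coord_op (X : Type) (o : mindex -> X -> X) (u : mindex -> X) :
    mindex -> X :=
  fun a => o a (u a).

Definition coordinatewise (R : realType) (X : normedModType R)
    (A : (mindex -> X) -> (mindex -> X)) : Prop :=
  exists o : mindex -> X -> X, {in kondratiev_union X, A =1 coord_op o}.

Definition wick (R : realType) (X : normedModType R)
    (B : mindex -> X -> X) (u : mindex -> X) : mindex -> X :=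
  fun a => \sum_(b \in [set b | mindex_le b a]) B b (u (mindex_sub a b)).

Definition bounded_operator (R : realType) (X : normedModType R)
    (f : {linear X -> X}) : Prop :=
  exists M : R, forall x, `|f x| <= M * `|x|.

Definition compact_operator (R : realType) (X : normedModType R)
    (f : {linear X -> X}) : Prop :=
  precompact (f @` [set x | `|x| <= 1]).

Definition opnorm (R : realType) (X : normedModType R)
    (f : {linear X -> X}) : R :=
  sup [set `|f x| | x in [set x | `|x| <= 1]].

(* Main.v *)
(* The equation is triangular: the coefficient at alpha reads
   [T_alpha u_alpha = - (f_alpha + sum_(0 < beta <= alpha) B_beta u_(alpha - beta))]
   with [T_alpha = At_alpha + r_alpha Id + B_0].  By the first hypothesis T_alpha
   is a perturbation of the scalar r_alpha by an operator of norm less than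
   - r_alpha, hence a bijection whose inverse has norm at most K, and the family
   (u_alpha) is determined by recursion on |alpha|.  With weights absorbed,
   [v_alpha = |u_alpha| (2N)^(- p alpha / 2)] satisfies [v <= K (g + c * v)]
   with g in l^2 and [K |c|_1 < 1 / sqrt 2]; summing squares over a finite
   downward closed set of multi-indices keeps the convolution inside this set
   and bounds the l^2 norm of v uniformly. *)
Require Import Defs.
From HB Require Import structures.
From mathcomp Require Import all_boot all_order all_algebra finmap.
From mathcomp Require Import all_classical all_reals all_analysis.
From mathcomp Require Import ring lra.

Set Implicit Arguments.
Unset Strict Implicit.
Unset Printing Implicit Defensive.

Import Order.TTheory GRing.Theory Num.Theory.
Import numFieldNormedType.Exports.

Local Open Scope classical_set_scope.
Local Open Scope ring_scope.

(** * Perturbations of scalars and operator norms *)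

(** A solution is a fixed point of [x |-> s^-1 *: (f x + y)], a contraction of ratio [M / s < 1] on
    a complete space. *)
Lemma lipschitz_scale_surjective (R : realType) (X : completeNormedModType R)
    (f : X -> X) (M s : R) (y : X) :
  0 <= M -> M < s -> (forall u v, `|f u - f v| <= M * `|u - v|) ->
  exists x, s *: x = f x + y.
Proof.
move=> M0 Ms fM; have s0 : 0 < s by exact: le_lt_trans Ms.
pose g : X -> X := fun x => s^-1 *: (f x + y).
pose gF : {fun [set: X] >-> [set: X]} :=
  mkfun (fun x (_ : [set: X] x) => I : [set: X] (g x)).
have q0 : 0 <= M / s by rewrite divr_ge0// ltW.
have ctr : is_contraction gF.
  exists (NngNum q0); split => /=; first by rewrite ltr_pdivrMr// mul1r.
  move=> [u v] _ /=; rewrite /g -scalerBr normrZ gtr0_norm ?invr_gt0//.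
  by rewrite opprD addrACA subrr addr0 mulrAC mulrC ler_pM2r ?invr_gt0.
have [||x _ xE] := banach_fixed_point ctr.
- exact: closedT.
- by exists 0.
by exists x; rewrite {1}xE /= /g scalerA divff ?gt_eqF// scale1r.
Qed.

(** Some bound [M] on the unit ball makes the [sup] in [opnorm] a true supremum rather than a
    default value; the rest is homogeneity. *)
Lemma opnorm_bound (R : realType) (X : normedModType R) (f : {linear X -> X})
    (M : R) :
  (forall x, `|x| <= 1 -> `|f x| <= M) ->
  forall x, `|f x| <= opnorm f * `|x|.
Proof.
move=> fM x; have [->|x0] := eqVneq x 0; first by rewrite linear0 !normr0 mulr0.
have nx0 : 0 < `|x| by rewrite normr_gt0.
have : `|f (`|x|^-1 *: x)| <= opnorm f.
  apply: ub_le_sup; first by exists M => _ [z /= z1 <-]; exact: fM.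
  exists (`|x|^-1 *: x) => //=.
  by rewrite normrZ gtr0_norm ?invr_gt0// mulVf// gt_eqF.
by rewrite linearZ normrZ gtr0_norm ?invr_gt0// mulrC ler_pdivrMr.
Qed.

Lemma opnorm_ge0 (R : realType) (X : normedModType R) (f : {linear X -> X}) :
  0 <= opnorm f.
Proof.
have [ub|nub] := pselect (has_ubound [set `|f x| | x in [set x | `|x| <= 1]]).
  rewrite (le_trans (normr_ge0 (f 0)))//; apply: ub_le_sup => //.
  by exists 0 => //=; rewrite normr0.
(* With no upper bound, [sup] takes its default value 0. *)
by rewrite /opnorm sup_out// => -[].
Qed.

Lemma bounded_opnorm (R : realType) (X : normedModType R)
    (f : {linear X -> X}) :
  bounded_operator f -> forall x, `|f x| <= opnorm f * `|x|.
Proof.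
move=> [M fM]; apply: (@opnorm_bound _ _ _ `|M|) => x x1.
rewrite (le_trans (fM x))// (le_trans (ler_wpM2r _ (ler_norm M)))//.
by rewrite ler_piMr.
Qed.

Lemma compact_opnorm (R : realType) (X : normedModType R)
    (f : {linear X -> X}) :
  compact_operator f -> forall x, `|f x| <= opnorm f * `|x|.
Proof.
move=> [C fC [/compact_bounded[M [_ CM]] _]].
(* Boundedness of the compact set gives a bound for each real strictly above [M]. *)
apply: (@opnorm_bound _ _ _ (M + 1)) => x x1.
by apply: (CM (M + 1)); rewrite ?ltrDl//; apply: fC; exists x.
Qed.

(** Weighted Cauchy-Schwarz by the discriminant argument: the sum of [c i * (y i - t) ^+ 2] is a
    nonnegative quadratic in [t], evaluated at its minimum [t = S / C]. *)
Lemma sqr_sum_weighted (R : realFieldType) (I : Type) (s : seq I) (P : pred I)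
    (c y : I -> R) : (forall i, P i -> 0 <= c i) ->
  (\sum_(i <- s | P i) c i * y i) ^+ 2 <=
  (\sum_(i <- s | P i) c i) * \sum_(i <- s | P i) c i * y i ^+ 2.
Proof.
move=> c0; set S := \sum_(i <- s | P i) c i * y i.
set C := \sum_(i <- s | P i) c i; set Q := \sum_(i <- s | P i) c i * y i ^+ 2.
have C0 : 0 <= C by exact: sumr_ge0.
have H t : 0 <= Q - 2 * t * S + t ^+ 2 * C.
  have -> : Q - 2 * t * S + t ^+ 2 * C =
      \sum_(i <- s | P i) c i * (y i - t) ^+ 2.
    rewrite /Q /S /C !mulr_sumr -sumrB -big_split/=.
    by apply: eq_bigr => i _; ring.
  by apply: sumr_ge0 => i Pi; rewrite mulr_ge0 ?sqr_ge0 ?c0.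
have [C0'|Cn0] := eqVneq C 0.
  (* For [C = 0] the quadratic is affine in [t]; if [S] were nonzero, this [t] would give it the
     value -1. *)
  rewrite C0' mul0r; have := H ((Q + 1) / (2 * S)); rewrite C0' mulr0 addr0.
  have [->|S0] := eqVneq S 0; first by rewrite expr0n.
  have -> : Q - 2 * ((Q + 1) / (2 * S)) * S = -1 by field.
  lra.
have Cp : 0 < C by rewrite lt0r Cn0.
have : 0 <= C * (Q - 2 * (S / C) * S + (S / C) ^+ 2 * C) by rewrite mulr_ge0.
have -> : C * (Q - 2 * (S / C) * S + (S / C) ^+ 2 * C) = C * Q - S ^+ 2 by field.
by rewrite subr_ge0.
Qed.

(** * Multi-indices, weights and the Wick product *)

(** Moves everything attached to [b] and to [a - b] onto the support of [a], where the two can be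
    multiplied or added termwise. *)
Lemma big_mindex_le (T : Type) (idx : T) (op : Monoid.com_law idx)
    (F : nat -> nat -> T) (b a : mindex) :
  (forall n, F n 0%N = idx) -> mindex_le b a ->
  \big[op/idx]_(n <- finsupp b) F n (b n) =
  \big[op/idx]_(n <- finsupp a) F n (b n).
Proof.
move=> F0 ba; apply: big_fset_incl => [|n _ nb]; last by rewrite fsfun_dflt.
by apply/fsubsetP => n; rewrite !mem_finsupp -!lt0n => /leq_trans; exact.
Qed.

Lemma mindex_sub_le (a b : mindex) : mindex_le (mindex_sub a b) a.
Proof. by move=> n; rewrite mindex_subE leq_subr. Qed.

Lemma mindex_le_trans (a b c : mindex) :
  mindex_le a b -> mindex_le b c -> mindex_le a c.
Proof. by move=> ab bc n; exact: leq_trans (bc n). Qed.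

Lemma mindex_sub0 (a : mindex) : mindex_sub a mindex0 = a.
Proof. by apply/fsfunP => n; rewrite mindex_subE fsfun0E subn0. Qed.

Lemma mindex_sub_inj (a a' b : mindex) : mindex_le b a -> mindex_le b a' ->
  mindex_sub a b = mindex_sub a' b -> a = a'.
Proof.
move=> ba ba' /fsfunP e; apply/fsfunP => n; have := e n.
by rewrite !mindex_subE => /(congr1 (addn (b n))); rewrite !subnKC.
Qed.

Definition mdeg (a : mindex) : nat := (\sum_(n <- finsupp a) a n)%N.

Lemma mdeg_sub (a b : mindex) : mindex_le b a -> b <> mindex0 ->
  (mdeg (mindex_sub a b) < mdeg a)%N.
Proof.
move=> ba b0.
have -> : mdeg a = (mdeg b + mdeg (mindex_sub a b))%N.
  rewrite /mdeg (big_mindex_le _ (F := fun _ k => k) _ ba)//.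
  rewrite (big_mindex_le _ (F := fun _ k => k) _ (mindex_sub_le a b))//.
  rewrite -big_split/=; apply: eq_bigr => n _.
  by rewrite mindex_subE subnKC.
rewrite -[ltnLHS]add0n ltn_add2r lt0n; apply/eqP => /eqP.
rewrite /mdeg sum_nat_seq_eq0 => /allP bn0; apply: b0.
apply/fsfunP => n; rewrite fsfun0E.
by case: finsuppP => // nb; apply/eqP; exact: bn0.
Qed.

Lemma weight_ge0 (R : realType) (c : R) (a : mindex) : 0 <= weight c a.
Proof. by apply: prodr_ge0 => n _; exact: powR_ge0. Qed.

Lemma weight_sub (R : realType) (c : R) (a b : mindex) : mindex_le b a ->
  weight c a = weight c b * weight c (mindex_sub a b).
Proof.
move=> ba; rewrite /weight.
pose F n k : R := (2 * n.+1)%:R `^ (c * k%:R).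
have F0 n : F n 0%N = 1 by rewrite /F mulr0 powRr0.
rewrite (big_mindex_le _ F0 ba) (big_mindex_le _ F0 (mindex_sub_le a b)).
rewrite -big_split/=; apply: eq_bigr => n _.
rewrite /F -powRD ?pnatr_eq0 ?implybT//.
by rewrite -mulrDr -natrD mindex_subE subnKC.
Qed.

Lemma weight_half_sqr (R : realType) (p : R) (a : mindex) :
  weight (- p / 2) a ^+ 2 = weight (- p) a.
Proof.
rewrite /weight expr2 -big_split/=; apply: eq_bigr => n _.
rewrite -powRD ?pnatr_eq0 ?implybT//; congr (_ `^ _).
by field.
Qed.

Definition mindex_below (a : mindex) : {fset mindex} :=
  fset_set ([set b | mindex_le b a] `\ mindex0).

Lemma mem_mindex_below (a b : mindex) :
  (b \in mindex_below a) <-> (mindex_le b a /\ b <> mindex0).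
Proof.
rewrite /mindex_below in_fset_set ?inE//.
by apply: finite_setD; exact: finite_mindex_le.
Qed.

(** Isolates the term at 0, the only one that involves [u a] itself; it goes into the operator to be
    inverted. *)
Lemma wick_recl (R : realType) (X : normedModType R) (B : mindex -> X -> X)
    (u : mindex -> X) (a : mindex) :
  wick B u a = B mindex0 (u a) +
    \sum_(b <- mindex_below a) B b (u (mindex_sub a b)).
Proof.
have fin := finite_mindex_le a.
rewrite /wick (fsbigD1 mindex0)//=; last by move=> n; rewrite fsfun0E.
by rewrite mindex_sub0 fsbig_finite//; exact: finite_setD.
Qed.

(** * Convolution estimates on finite sets *)

Lemma ler_sum_fsubset (R : numDomainType) (I : choiceType) (S D : {fset I})
    (F : I -> R) : (S `<=` D)%fset -> (forall i, 0 <= F i) ->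
  \sum_(i <- S) F i <= \sum_(i <- D) F i.
Proof.
move=> SD F0; rewrite [leRHS](big_fsetID _ (mem S))/= -[leLHS]addr0.
apply: lerD; last by apply: sumr_ge0.
rewrite le_eqVlt; apply/orP; left; apply/eqP; apply: eq_fbigl => i.
by rewrite !inE /=; case: (boolP (i \in S)) => [/(fsubsetP SD) ->|]; rewrite ?andbF.
Qed.

Lemma mindex_down_closure (S : {fset mindex}) : exists D : {fset mindex},
  (S `<=` D)%fset /\
  (forall a b, a \in D -> mindex_le b a -> b \in D).
Proof.
pose E := \bigcup_(a in [set` S]) [set b | mindex_le b a].
have finE : finite_set E.
  by apply: bigcup_finite => // a _; exact: finite_mindex_le.
exists (fset_set E); split.
  by apply/fsubsetP => a aS; rewrite in_fset_set// inE; exists a.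
move=> a b; rewrite !in_fset_set// !inE => -[c /= cS ac] ba.
by exists c => //; exact: mindex_le_trans ac.
Qed.

(** Young's inequality in l^1, localized to [D]: after exchanging the sums, for fixed [b] the shifts
    [a - b] are distinct and stay in [D]. *)
Lemma sum_convolution_le (R : realType) (c w : mindex -> R) (C : R)
    (D : {fset mindex}) :
  (forall b, 0 <= c b) -> (forall a, 0 <= w a) ->
  (forall T : {fset mindex}, mindex0 \notin T -> \sum_(b <- T) c b <= C) ->
  (forall a b, a \in D -> mindex_le b a -> b \in D) ->
  \sum_(a <- D) \sum_(b <- mindex_below a) c b * w (mindex_sub a b) <=
  C * \sum_(a <- D) w a.
Proof.
move=> c0 w0 cC Dd.
(* Downward closure lets [b] range over a set independent of [a], as the exchange requires. *)
have -> : \sum_(a <- D) \sum_(b <- mindex_below a) c b * w (mindex_sub a b) =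
   \sum_(a <- D) \sum_(b <- (D `\ mindex0)%fset | `[< mindex_le b a >])
     c b * w (mindex_sub a b).
  apply: eq_big_seq => a aD; rewrite [RHS]big_fset_condE; apply: eq_fbigl => b.
  apply/idP/idP; rewrite !inE/=.
    move/mem_mindex_below => [ba /eqP b0].
    by rewrite b0 (Dd a)//=; apply/asboolP.
  by case/andP => /andP[/eqP b0 _] /asboolP ba; apply/mem_mindex_below.
rewrite (exchange_big_dep xpredT)//=.
apply: (@le_trans _ _
  (\sum_(b <- (D `\ mindex0)%fset) c b * \sum_(a <- D) w a)); last first.
  rewrite -mulr_suml ler_wpM2r ?sumr_ge0//; apply: cC.
  by rewrite !inE eqxx.
apply: ler_sum => b _; rewrite -mulr_sumr ler_wpM2l//.
rewrite big_fset_condE; set E := [fset a in D | _]%fset.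
have -> : \sum_(a <- E) w (mindex_sub a b) =
    \sum_(x <- [fset mindex_sub a b | a in E]%fset) w x.
  rewrite [RHS]big_imfset//= => a a'; rewrite !inE/=.
  by move=> /andP[_ /asboolP ba] /andP[_ /asboolP ba']; exact: mindex_sub_inj.
apply: ler_sum_fsubset => //; apply/fsubsetP => x /imfsetP[a /=].
rewrite !inE => /andP[aD _] ->.
by apply: (Dd a) => //; exact: mindex_sub_le.
Qed.

(* [(x + y)^2 <= 2 x^2 + 2 y^2] is where the factor [1 / sqrt 2] comes from. *)
Lemma convolution_inequality_l2 (R : realType) (c v g : mindex -> R)
    (K C G : R) :
  (forall b, 0 <= c b) -> (forall a, 0 <= v a) -> (forall a, 0 <= g a) ->
  0 <= K -> 2 * (K * C) ^+ 2 < 1 ->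
  (forall T : {fset mindex}, mindex0 \notin T -> \sum_(b <- T) c b <= C) ->
  (forall T : {fset mindex}, \sum_(a <- T) g a ^+ 2 <= G) ->
  (forall a, v a <=
     K * (g a + \sum_(b <- mindex_below a) c b * v (mindex_sub a b))) ->
  forall S : {fset mindex},
    \sum_(a <- S) v a ^+ 2 <= 2 * K ^+ 2 * G / (1 - 2 * (K * C) ^+ 2).
Proof.
move=> c0 v0 g0 K0 KC cC gG vle S.
have [D [SD Dd]] := mindex_down_closure S.
have v20 a : 0 <= v a ^+ 2 by exact: sqr_ge0.
apply: le_trans (ler_sum_fsubset SD v20) _.
have C0 : 0 <= C by have := cC fset0; rewrite big_seq_fset0; apply.
have := sum_convolution_le c0 v20 cC Dd.
set V := \sum_(a <- D) v a ^+ 2.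
set W := \sum_(a <- D) _ => WC.
have VW : V <= 2 * K ^+ 2 * (G + C * W).
  apply: (@le_trans _ _ (\sum_(a <- D) 2 * K ^+ 2 * (g a ^+ 2 +
    C * \sum_(b <- mindex_below a) c b * v (mindex_sub a b) ^+ 2))).
    apply: ler_sum => a _.
    set s := \sum_(b <- mindex_below a) c b * v (mindex_sub a b).
    have s0 : 0 <= s by apply: sumr_ge0 => b _; exact: mulr_ge0.
    (* Cauchy-Schwarz with weights [c b], whose total mass is at most [C]. *)
    have s2 : s ^+ 2 <=
        C * \sum_(b <- mindex_below a) c b * v (mindex_sub a b) ^+ 2.
      rewrite (le_trans (sqr_sum_weighted _ _ _))// ler_wpM2r//.
        by apply: sumr_ge0 => b _; exact: mulr_ge0.
      by apply: cC; apply/negP => /mem_mindex_below[].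
    apply: (@le_trans _ _ ((K * (g a + s)) ^+ 2)).
      by rewrite lerXn2r// ?nnegrE ?mulr_ge0 ?addr_ge0//; exact: vle.
    rewrite exprMn [2 * _]mulrC -[leRHS]mulrA ler_wpM2l ?sqr_ge0//.
    have := sqr_ge0 (g a - s); nra.
  rewrite -mulr_sumr ler_wpM2l ?mulr_ge0 ?sqr_ge0//.
  by rewrite big_split/= -mulr_sumr lerD.
(* With [W <= C * V] this becomes [V <= 2 K^2 G + 2 (K C)^2 V]; [V] is a finite sum, so the last
   term can be absorbed on the left. *)
rewrite ler_pdivlMr ?subr_gt0//.
have : 2 * K ^+ 2 * (C * W) <= 2 * K ^+ 2 * (C * (C * V)).
  by rewrite ler_wpM2l ?mulr_ge0 ?sqr_ge0// ler_wpM2l.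
rewrite exprMn; lra.
Qed.

(** A nonnegative series is finite exactly when its finite partial sums are uniformly bounded; the
    half weight turns its terms into squares. *)
Lemma kondratievP (R : realType) (X : normedModType R) (p : R)
    (u : mindex -> X) :
  kondratiev X p u <-> exists G, forall T : {fset mindex},
    \sum_(a <- T) (`|u a| * weight (- p / 2) a) ^+ 2 <= G.
Proof.
rewrite /kondratiev /=.
have E a : `|u a| ^+ 2 * weight (- p) a = (`|u a| * weight (- p / 2) a) ^+ 2.
  by rewrite exprMn weight_half_sqr.
under eq_esum do rewrite E.
set f := fun a => (`|u a| * weight (- p / 2) a) ^+ 2.
have f0 a : [set: mindex] a -> (0 <= (f a)%:E)%E.
  by rewrite lee_fin sqr_ge0.
split=> [|[G uG]].
  have := esum_ge0 f0; case E' : (\esum_(a in _) _)%E => [G| |]// _ _.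
  exists G => T; rewrite -lee_fin -E'; apply: esum_ge.
  exists [set` T]; first by split => //; exact: finite_fset.
  by rewrite -sumEFin fsbig_seq ?fset_uniq.
apply: (@le_lt_trans _ _ G%:E); last by rewrite ltry.
apply: ge_ereal_sup => _ [T [finT _] <-].
by rewrite fsbig_finite// sumEFin lee_fin.
Qed.

Lemma mindex_below_mdeg (a b : mindex) : b \in mindex_below a ->
  (mdeg (mindex_sub a b) < mdeg a)%N.
Proof. by move=> /mem_mindex_below[]; exact: mdeg_sub. Qed.

(** Iterates of [Phi] from a constant family stabilize: the value at [a] is final after
    [(mdeg a).+1] steps. *)
Lemma mindex_recursion (X : Type) (x0 : X)
    (Phi : (mindex -> X) -> mindex -> X) :
  (forall u v a, (forall b, (mdeg b < mdeg a)%N -> u b = v b) ->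
     Phi u a = Phi v a) ->
  exists u, forall a, u a = Phi u a.
Proof.
move=> PhiE; pose f n := iter n Phi (fun=> x0).
have fE n : forall m1 m2 a,
    (mdeg a < n)%N -> (mdeg a < m1)%N -> (mdeg a < m2)%N -> f m1 a = f m2 a.
  elim: n => // n IH [//|m1] [//|m2] a an am1 am2; apply: PhiE => b ba.
  by apply: IH; exact: leq_trans ba _.
exists (fun a => f (mdeg a).+1 a) => a; apply: PhiE => b ba.
exact: (fE (mdeg b).+1).
Qed.

Theorem theorem4p1 (R : realType) (X : completeNormedModType R)
    (A : (mindex -> X) -> (mindex -> X))
    (At B : mindex -> {linear X -> X}) (r : mindex -> R) (K p : R)
    (A_fun : set_fun (kondratiev_union X) (kondratiev_union X) A)
    (A_coord : coordinatewise A)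
    (B_fun : set_fun (kondratiev_union X) (kondratiev_union X) (wick B))
    (B_bounded : forall a, bounded_operator (B a))
    (A_split : forall U, kondratiev_union X U ->
       A U = coord_op At U + coord_op (fun a x => r a *: x) U)
    (At_compact : forall a, compact_operator (At a))
    (B0_compact : compact_operator (B mindex0))
    (K_gt0 : 0 < K)
    (denom_ge0 : forall a, 0 <= - opnorm (At a) - opnorm (B mindex0) - r a)
    (sup_ltK : (ereal_sup [set ((- r a - opnorm (At a) - opnorm (B mindex0))%:E)^-1
                          | a in [set: mindex]] < K%:E)%E)
    (p_gt0 : 0 < p)
    (B_small : (K%:E * (\esum_(b in [set b | b <> mindex0])
                   (opnorm (B b) * weight (- p / 2) b)%:E)
                < (1 / Num.sqrt 2)%:E)%E)
    (ker0 : forall a,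
       [set x | At a x + (1 + r a) *: x + B mindex0 x = 0] = [set 0]) :
  forall F : mindex -> X, kondratiev X p F ->
    exists! U : mindex -> X, kondratiev X p U /\ A U + wick B U + F = 0.
Proof.

(* Inversion of the diagonal operators *)
set nA := fun a => opnorm (At a); set n0 := opnorm (B mindex0).
have d_gt0 a : 0 < - r a - nA a - n0 /\ 1 <= K * (- r a - nA a - n0).
  set d := _ - n0.
  have d0 : 0 <= d by rewrite /d; have := denom_ge0 a; rewrite -/(nA a) -/n0; lra.
  have : ((d%:E)^-1 < K%:E)%E.
    by apply: le_lt_trans sup_ltK; apply: ereal_sup_ubound; exists a.
  (* The inverse of 0 is [+oo], which is not below [K], so [d] cannot vanish. *)
  rewrite inver; case: eqP => [//|/eqP dn0].
  have dp : 0 < d by rewrite lt0r dn0.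
  by rewrite lte_fin -[_^-1]mul1r ltr_pdivrMr// => /ltW.
have Bn b x : `|B b x| <= opnorm (B b) * `|x| by exact: bounded_opnorm.
have An a x : `|At a x| <= nA a * `|x| by exact: compact_opnorm.
pose T a x := At a x + r a *: x + B mindex0 x.
have TB a x y : T a (x - y) = T a x - T a y.
  rewrite /T !linearB/= [in RHS]opprD [RHS]addrACA.
  by rewrite [in RHS]opprD [in RHS](addrACA (At a x)).
have Tlow a x : `|x| <= K * `|T a x|.
  have [_ dK] := d_gt0 a.
  (* Writing [- r a *: x] as [- T a x + At a x + B mindex0 x] and taking norms bounds [d * |x|] by
     [|T a x|], and [1 <= K * d]. *)
  have : - r a * `|x| <= `|T a x| + nA a * `|x| + n0 * `|x|.
    rewrite (le_trans (ler_wpM2r _ (ler_norm _)))// -normrZ scaleNr.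
    have -> : - (r a *: x) = - T a x + At a x + B mindex0 x.
      by rewrite /T (addrAC (At a x)) opprD -addrA [RHS]addrAC addNr add0r.
    rewrite (le_trans (ler_normD _ _))// lerD//.
    by rewrite (le_trans (ler_normD _ _))// lerD// normrN.
  have := ler_wpM2r (normr_ge0 x) dK; rewrite mul1r => h1 h2.
  rewrite (le_trans h1)// -mulrA ler_wpM2l ?(ltW K_gt0)//; lra.
have Tsurj a y : exists x, T a x = y.
  have [dp _] := d_gt0 a.
  (* [T a x = y] is read as [- r a *: x = (At a x + B mindex0 x) - y], with Lipschitz constant
     [nA a + n0 < - r a]. *)
  have [||u v|x xE] := @lipschitz_scale_surjective R X
    (fun x => At a x + B mindex0 x) (nA a + n0) (- r a) (- y).
  - by rewrite addr_ge0// opnorm_ge0.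
  - by rewrite -subr_gt0 opprD addrA.
  - rewrite opprD addrACA -!linearB mulrDl.
    by rewrite (le_trans (ler_normD _ _))// lerD.
  exists x; rewrite /T addrAC; apply/eqP; rewrite -subr_eq0 (addrAC (_ + _)) -xE.
  by rewrite scaleNr addNr.
pose S a y := sval (cid (Tsurj a y)).
have TS a y : T a (S a y) = y by exact: svalP (cid (Tsurj a y)).

(* Triangular form of the equation and existence *)
pose rest u a := \sum_(b <- mindex_below a) B b (u (mindex_sub a b)).
have restE u v a : (forall b, (mdeg b < mdeg a)%N -> u b = v b) ->
    rest u a = rest v a.
  by move=> uv; apply: eq_big_seq => b ba; rewrite uv// mindex_below_mdeg.
have eqnE F U : kondratiev X p U ->
    A U + wick B U + F = 0 <-> forall a, T a (U a) = - (rest U a + F a).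
  move=> Up; rewrite A_split; last by exists p => //=; exact: ltW.
  have E a : (coord_op At U + coord_op (fun a x => r a *: x) U + wick B U + F) a
      = T a (U a) + (rest U a + F a).
    by rewrite !fctE wick_recl /coord_op /T /rest !addrA.
  split=> [e a|e]; first by apply/eqP; rewrite -addr_eq0 -E e.
  by apply/funext => a; rewrite E e addNr.
move=> F Fp.
have [U UE] : exists U, forall a, U a = S a (- (rest U a + F a)).
  by apply: (mindex_recursion 0) => u v a uv; rewrite (restE u v).
have TU a : T a (U a) = - (rest U a + F a) by rewrite [in LHS]UE TS.

(* Summability of the solution *)
have Up : kondratiev X p U.
  move/kondratievP : Fp => [G FG].
  have esum0 : (0 <= \esum_(b in [set b | b <> mindex0])
      (opnorm (B b) * weight (- p / 2) b)%:E)%E.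
    by apply: esum_ge0 => b _; rewrite lee_fin mulr_ge0 ?opnorm_ge0 ?weight_ge0.
  have [C CE] : exists C, (\esum_(b in [set b | b <> mindex0])
      (opnorm (B b) * weight (- p / 2) b)%:E)%E = C%:E.
    move: esum0 B_small; case: (\esum_(b in _) _)%E => [C| |]// _.
      by exists C.
    (* An infinite sum times [K > 0] would be [+oo], against [B_small]. *)
    by rewrite gt0_muley ?lte_fin.
  rewrite CE in B_small esum0.
  have KC : 2 * (K * C) ^+ 2 < 1.
    move: B_small; rewrite -EFinM lte_fin => KC.
    have s0 : 0 < Num.sqrt 2 :> R by rewrite sqrtr_gt0.
    have : (K * C) ^+ 2 < (1 / Num.sqrt 2) ^+ 2.
      by rewrite ltrXn2r// mulr_ge0 ?(ltW K_gt0)// -lee_fin.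
    rewrite expr_div_n expr1n sqr_sqrtr//; lra.
  apply/kondratievP.
  exists (2 * K ^+ 2 * G / (1 - 2 * (K * C) ^+ 2)).
  apply: (@convolution_inequality_l2 R
    (fun b => opnorm (B b) * weight (- p / 2) b) _
    (fun a => `|F a| * weight (- p / 2) a)) => //.
  - by move=> b; rewrite mulr_ge0 ?opnorm_ge0 ?weight_ge0.
  - by move=> b; rewrite mulr_ge0 ?weight_ge0.
  - by move=> b; rewrite mulr_ge0 ?weight_ge0.
  - exact: ltW.
  - move=> V V0; rewrite -lee_fin -CE; apply: esum_ge.
    exists [set` V]; last by rewrite -sumEFin fsbig_seq ?fset_uniq.
    split=> [|b /= bV b0]; first exact: finite_fset.
    by rewrite -b0 bV in V0.
  move=> a.
  (* Multiplicativity of the weight factors out its value at [a], leaving an unweighted bound on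
     [U a] that follows from [Tlow]. *)
  have -> : \sum_(b <- mindex_below a) opnorm (B b) * weight (- p / 2) b *
      (`|U (mindex_sub a b)| * weight (- p / 2) (mindex_sub a b)) =
      (\sum_(b <- mindex_below a) opnorm (B b) * `|U (mindex_sub a b)|) *
      weight (- p / 2) a.
    rewrite mulr_suml; apply: eq_big_seq => b /mem_mindex_below[ba _].
    by rewrite (weight_sub _ ba); ring.
  rewrite -mulrDl mulrA ler_wpM2r ?weight_ge0//.
  rewrite (le_trans (Tlow a _))// ler_wpM2l ?(ltW K_gt0)// TU normrN addrC.
  rewrite (le_trans (ler_normD _ _))// lerD2l.
  by rewrite (le_trans (ler_norm_sum _ _ _))//; apply: ler_sum.

(* Uniqueness *)
exists U; split; first by split => //; apply/eqnE.
move=> V [Vp /(eqnE F V Vp) TV]; apply/funext => a.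
(* Strong induction on the degree: agreement below [a] makes [T a (U a)] and [T a (V a)] equal, and
   [Tlow] gives injectivity. *)
have [n] := ubnP (mdeg a); elim: n => // n IH in a *; rewrite ltnS => an.
apply/eqP; rewrite -subr_eq0 -normr_le0 (le_trans (Tlow a _))// TB TU TV.
rewrite (restE U V) ?subrr ?normr0 ?mulr0// => b ba.
by apply: IH; exact: leq_trans ba an.
Qed.
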